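(* Let $p\in(1,\infty)$, $\gamma\in(-1,\infty)$, $m\in[0,\gamma+1)$, and let $\mathfrak a:B_1\to(0,\infty)$ be continuous with $\inf_{B_1}\mathfrak a\ge\lambda_0>0$. Let $u\in C^0(B_1)$ be a non-negative bounded viscosity solution of $$|\nabla u(x)|^{\gamma}\Delta_p^{\mathrm N}u(x)=\mathfrak a(x)u_+^m(x)\quad\text{in }B_1,$$ and let $y\in\overline{\{u>0\}}\cap B_{1/2}$. Then there is a universal positive constant $C_{\mathrm{ND}}$ such that for all $r\in(0,1/2)$ $$\sup_{\overline B_r(y)}u\ \ge\ C_{\mathrm{ND}}\,r^{\beta},\qquad \beta=\frac{\gamma+2}{\gamma+1-m},$$ where $$C_{\mathrm{ND}}=C_{\mathrm{ND}}(\gamma,n,m,p,\lambda_0)=\frac1{\beta^{\frac{\gamma+1}{\gamma+1-m}}}\left[\frac{\lambda_0}{n-1+(p-1)(\beta-1)}\right]^{\frac1{\gamma+1-m}}>0.$$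
   Context: $B_r(x)$ is the open ball in $\mathbb R^n$ of radius $r$ centred at $x$, $B_r=B_r(0)$; $u_+=\max\{u,0\}$, $u_+^m=(u_+)^m$. A constant is universal if it depends only on $n,p,\gamma,m$ and the bounds of $\mathfrak a$. The normalized $p$-Laplacian is $\Delta_p^{\mathrm N}u=\Delta u+(p-2)\left\langle D^2u\,\frac{\nabla u}{|\nabla u|},\frac{\nabla u}{|\nabla u|}\right\rangle$. Viscosity solutions of $|\nabla u|^\gamma\Delta_p^{\mathrm N}u=f(x,u)$ in an open set $\Omega$ ($f$ continuous), for continuous $u$: Case $\gamma\ge0$. $u$ is a subsolution (resp. supersolution) if whenever $\phi\in C^2(\Omega)$ and $u-\phi$ has a local maximum (resp. minimum) at $x_0\in\Omega$ with $\phi(x_0)=u(x_0)$: (1) if $\nabla\phi(x_0)\ne0$, then $|\nabla\phi(x_0)|^\gamma\Delta_p^{\mathrm N}\phi(x_0)\ge f(x_0,\phi(x_0))$ (resp. $\le$); (2) if $\nabla\phi(x_0)=0$, then for $p\ge2$: $\Delta\phi(x_0)+(p-2)\lambda_{\max}(D^2\phi(x_0))\ge f(x_0,\phi(x_0))$ (resp. $\Delta\phi(x_0)+(p-2)\lambda_{\min}(D^2\phi(x_0))\le f(x_0,\phi(x_0))$), and for $1<p<2$ the same with $\lambda_{\max}$ and $\lambda_{\min}$ interchanged. Here $\lambda_{\max},\lambda_{\min}$ denote the largest and smallest eigenvalues. Case $-1<\gamma<0$. $u$ is a subsolution (resp. supersolution) if for all $\varphi\in C^2(\Omega)$ such that $u-\varphi$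 has a local maximum (resp. minimum) at $x_0$, $\varphi(x_0)=u(x_0)$, and $\nabla\varphi(x)\ne0$ for $x\ne x_0$, one has $\lim_{r\to0}\inf_{x\in B_r(x_0),x\ne x_0}\left(-|\nabla\varphi(x)|^\gamma\Delta_p^{\mathrm N}\varphi(x)\right)\le -f(x_0,\varphi(x_0))$ (resp. $\lim_{r\to0}\sup_{x\in B_r(x_0),x\ne x_0}\left(-|\nabla\varphi(x)|^\gamma\Delta_p^{\mathrm N}\varphi(x)\right)\ge -f(x_0,\varphi(x_0))$). A solution is both a subsolution and a supersolution. *)

(* Defs.v *)
From HB Require Import structures.
From mathcomp Require Import all_boot all_order all_algebra.
From mathcomp Require Import all_classical all_reals all_analysis.

Set Implicit Arguments.
Unset Strict Implicit.
Unset Printing Implicit Defensive.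

Import Order.TTheory GRing.Theory Num.Theory.
Import numFieldNormedType.Exports.

Local Open Scope classical_set_scope.
Local Open Scope ring_scope.

Section EuclideanSpace.
Context {R : realType} {n : nat}.
Implicit Types (x : 'rV[R]_n) (r : R).

(* The library norm on ['rV[R]_n] is the sup norm; it induces the usual
   topology, but its balls are cubes. *)
Definition enorm x : R := Num.sqrt (\sum_(i < n) x 0 i ^+ 2).

Definition eball x r : set 'rV[R]_n := [set z | enorm (z - x) < r].

End EuclideanSpace.

Section DifferentialOperators.
Context {R : realType} {n : nat}.
Implicit Types (phi : 'rV[R]_n -> R) (x : 'rV[R]_n) (Omega : set 'rV[R]_n).

Definition partial (i : 'I_n) phi : 'rV[R]_n -> R := 'D_(delta_mx 0 i) phi.

Definition has_partial (i : 'I_n) phi x : Prop :=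
  derivable phi x (delta_mx 0 i).

Definition grad phi x : 'rV[R]_n := \row_(i < n) partial i phi x.

Definition hessian phi x : 'M[R]_n :=
  \matrix_(i < n, j < n) partial i (partial j phi) x.

Definition laplacian phi x : R := \tr (hessian phi x).

(* Meant for open [Omega]. *)
Definition class_C2 Omega phi : Prop :=
  [/\ {in Omega, continuous phi},
      forall i, (forall x, Omega x -> has_partial i phi x) /\
                {in Omega, continuous (partial i phi)}
    & forall i j, (forall x, Omega x -> has_partial i (partial j phi) x) /\
                  {in Omega, continuous (partial i (partial j phi))}].

(* Meaningful only where [grad phi x != 0]. *)
Definition normalized_pLaplacian (p : R) phi x : R :=
  let nu := (enorm (grad phi x))^-1 *: grad phi x in
  laplacian phi x + (p - 2) * (nu *m hessian phi x *m nu^T) 0 0.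

Definition pLaplace_op (p gamma : R) phi x : R :=
  enorm (grad phi x) `^ gamma * normalized_pLaplacian p phi x.

(* For a symmetric real matrix of positive size the set of eigenvalues is finite
   and non-empty, so that the supremum and the infimum are attained. *)
Definition lambda_max (A : 'M[R]_n) : R := sup [set a | eigenvalue A a].
Definition lambda_min (A : 'M[R]_n) : R := inf [set a | eigenvalue A a].

End DifferentialOperators.

Section ViscositySolutions.
Context {R : realType} {n : nat}.
Variables (p gamma : R) (f : 'rV[R]_n -> R -> R) (Omega : set 'rV[R]_n).
Implicit Types (u phi : 'rV[R]_n -> R) (x : 'rV[R]_n).

Definition touches_from_above phi u (x0 : 'rV[R]_n) : Prop :=
  (\forall x \near x0, u x - phi x <= u x0 - phi x0) /\ phi x0 = u x0.

Definition touches_from_below phi u (x0 : 'rV[R]_n) : Prop :=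
  (\forall x \near x0, u x - phi x >= u x0 - phi x0) /\ phi x0 = u x0.

Definition visc_sub_ge0 u : Prop :=
  forall phi x0, class_C2 Omega phi -> Omega x0 ->
    touches_from_above phi u x0 ->
    (grad phi x0 != 0 -> pLaplace_op p gamma phi x0 >= f x0 (phi x0)) /\
    (grad phi x0 = 0 ->
       (2 <= p -> laplacian phi x0 + (p - 2) * lambda_max (hessian phi x0)
                    >= f x0 (phi x0)) /\
       (p < 2 -> laplacian phi x0 + (p - 2) * lambda_min (hessian phi x0)
                    >= f x0 (phi x0))).

Definition visc_super_ge0 u : Prop :=
  forall phi x0, class_C2 Omega phi -> Omega x0 ->
    touches_from_below phi u x0 ->
    (grad phi x0 != 0 -> pLaplace_op p gamma phi x0 <= f x0 (phi x0)) /\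
    (grad phi x0 = 0 ->
       (2 <= p -> laplacian phi x0 + (p - 2) * lambda_min (hessian phi x0)
                    <= f x0 (phi x0)) /\
       (p < 2 -> laplacian phi x0 + (p - 2) * lambda_max (hessian phi x0)
                    <= f x0 (phi x0))).

(* Values of [- |grad phi|^gamma Delta_p^N phi] on the punctured ball. The limits
   below are taken in [\bar R], where they always exist by monotonicity. *)
Definition neg_op_values phi (x0 : 'rV[R]_n) (r : R) : set (\bar R) :=
  [set (- pLaplace_op p gamma phi x)%:E | x in eball x0 r `\ x0].

Definition visc_sub_lt0 u : Prop :=
  forall phi x0, class_C2 Omega phi -> Omega x0 ->
    touches_from_above phi u x0 ->
    (forall x, Omega x -> x <> x0 -> grad phi x != 0) ->
    (lim (ereal_inf (neg_op_values phi x0 r) @[r --> 0^'+])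
       <= (- f x0 (phi x0))%:E)%E.

Definition visc_super_lt0 u : Prop :=
  forall phi x0, class_C2 Omega phi -> Omega x0 ->
    touches_from_below phi u x0 ->
    (forall x, Omega x -> x <> x0 -> grad phi x != 0) ->
    (lim (ereal_sup (neg_op_values phi x0 r) @[r --> 0^'+])
       >= (- f x0 (phi x0))%:E)%E.

Definition visc_subsolution u : Prop :=
  if 0 <= gamma then visc_sub_ge0 u else visc_sub_lt0 u.

Definition visc_supersolution u : Prop :=
  if 0 <= gamma then visc_super_ge0 u else visc_super_lt0 u.

Definition visc_solution u : Prop :=
  visc_subsolution u /\ visc_supersolution u.

End ViscositySolutions.

(* [0 `^ 0 = 1], so that for [m = 0] this is [a x], which is continuous in
   [(x, t)] as the definition of viscosity solutions requires. *)
Definition absorption {R : realType} {n : nat} (a : 'rV[R]_n -> R) (m : R)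
    (x : 'rV[R]_n) (t : R) : R :=
  a x * (Num.max t 0) `^ m.

Definition beta_exp {R : realType} (gamma m : R) : R :=
  (gamma + 2) / (gamma + 1 - m).

Definition C_ND {R : realType} (gamma : R) (n : nat) (m p lambda0 : R) : R :=
  let b := beta_exp gamma m in
  1 / b `^ ((gamma + 1) / (gamma + 1 - m))
  * (lambda0 / (n%:R - 1 + (p - 1) * (b - 1))) `^ (1 / (gamma + 1 - m)).

(* Main.v *)
Require Import Defs.
From mathcomp Require Import all_boot all_order all_algebra.
From mathcomp Require Import all_classical all_reals all_analysis.
From mathcomp Require Import ring lra zify.

Import Order.TTheory GRing.Theory Num.Theory.
Import numFieldNormedType.Exports.

Local Open Scope classical_set_scope.
Local Open Scope ring_scope.

(**
The barrier [C |x - z|^beta] has [|grad|^gamma Delta_p^N = lambda C^m |x - z|^(beta m)]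
with [lambda < lambda0] exactly when [C < C_ND]. If [sup u < C_ND r^beta] on the ball,
then for all [z] close to [y] with [u z > 0] and a suitable [C < C_ND], the maximum of
[u - C |x - z|^beta] over a slightly smaller closed ball around [z] is positive and
interior; by the viscosity inequality it cannot be attained at a point other than [z].
At [z] itself the barrier need not be an admissible test function, but if the maximum is
at [z] for all such [z], then [u x <= u z + C |x - z|^beta] for all [x] and [z] in some
open set; since [beta > 1], [u] is a positive constant there, and a sufficiently flat
test function contradicts the equation.
*)

(** * Euclidean geometry *)

Lemma powR_continuous_at {R : realType} (g a : R) :
  0 < a -> {for a, continuous (fun b => b `^ g)}.
Proof.
move=> a0; apply/differentiable_continuous/derivable1_diffP.
by case: (is_derive1_powR g a0).
Qed.

Lemma continuous_powR {R : realType} {T : topologicalType} (N : T -> R) (g : R) x :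
  {for x, continuous N} -> 0 < N x -> {for x, continuous (fun z => N z `^ g)}.
Proof.
move=> cN N0; apply: (@continuous_comp _ _ _ N (fun b : R => b `^ g) x cN).
exact: powR_continuous_at.
Qed.

Lemma continuous_sumr {R : realType} {T : topologicalType} k
    (f : 'I_k -> T -> R) (x : T) :
  (forall i, {for x, continuous (f i)}) ->
  {for x, continuous (fun z => \sum_(i < k) f i z)}.
Proof.
move=> fx; apply: cvg_big => [z|i _]; last exact: fx.
exact: (@add_continuous R).
Qed.

Section InnerProduct.
Context {R : realType} {n : nat}.
Implicit Types u v w x : 'rV[R]_n.

Definition dot u v : R := \sum_(i < n) u 0 i * v 0 i.

Lemma dotC u v : dot u v = dot v u.
Proof. by apply: eq_bigr => i _; rewrite mulrC. Qed.

Lemma dotDl u v w : dot (u + v) w = dot u w + dot v w.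
Proof. by rewrite /dot -big_split; apply: eq_bigr => i _; rewrite mxE mulrDl. Qed.

Lemma dotZl k u v : dot (k *: u) v = k * dot u v.
Proof. by rewrite /dot mulr_sumr; apply: eq_bigr => i _; rewrite mxE mulrA. Qed.

Lemma dotNl u v : dot (- u) v = - dot u v.
Proof. by rewrite -scaleN1r dotZl mulN1r. Qed.

Lemma dotDr u v w : dot w (u + v) = dot w u + dot w v.
Proof. by rewrite dotC dotDl !(dotC w). Qed.

Lemma dotZr k u v : dot u (k *: v) = k * dot u v.
Proof. by rewrite dotC dotZl (dotC u). Qed.

Lemma dotNr u v : dot u (- v) = - dot u v.
Proof. by rewrite dotC dotNl (dotC u). Qed.

Lemma dot0l u : dot 0 u = 0.
Proof. by rewrite -(scale0r (0 : 'rV_n)) dotZl mul0r. Qed.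

Lemma dot_delta u i : dot u (delta_mx 0 i) = u 0 i.
Proof.
rewrite /dot (bigD1 i)//= mxE !eqxx mulr1 big1 ?addr0// => j ji.
by rewrite mxE eqxx (negbTE ji) mulr0.
Qed.

Lemma dot_ge0 u : 0 <= dot u u.
Proof. by apply: sumr_ge0 => i _; rewrite -expr2 sqr_ge0. Qed.

Lemma dot_eq0 u : (dot u u == 0) = (u == 0).
Proof.
apply/idP/eqP => [|->]; last by rewrite dot0l.
rewrite psumr_eq0 => [/allP u0|i _]; last by rewrite -expr2 sqr_ge0.
apply/rowP => i; rewrite mxE; apply/eqP.
by have := u0 i (mem_index_enum _); rewrite mulf_eq0 orbb.
Qed.

(** The square of [dot v v *: u - dot u v *: v] is non-negative and equals [dot v v] times the
    difference of the two sides, whence the separate case [v = 0]. *)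
Lemma dot_CauchySchwarz u v : dot u v ^+ 2 <= dot u u * dot v v.
Proof.
have [->|v0] := eqVneq v 0; first by rewrite dotC !dot0l expr0n mulr0.
have vv : 0 < dot v v by rewrite lt_neqAle eq_sym dot_eq0 v0 dot_ge0.
rewrite -subr_ge0 -(pmulr_rge0 _ vv).
have := dot_ge0 (dot v v *: u - dot u v *: v).
rewrite !(dotDl, dotDr, dotNl, dotNr, dotZl, dotZr) (dotC v u).
by move/le_trans; apply; rewrite le_eqVlt; apply/orP; left; apply/eqP; ring.
Qed.

Lemma enormE u : enorm u = Num.sqrt (dot u u).
Proof. by congr Num.sqrt; apply: eq_bigr => i _; rewrite expr2. Qed.

Lemma sqr_enorm u : enorm u ^+ 2 = dot u u.
Proof. by rewrite enormE sqr_sqrtr ?dot_ge0. Qed.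

Lemma enorm_ge0 u : 0 <= enorm u.
Proof. by rewrite enormE sqrtr_ge0. Qed.

Lemma enorm0 : enorm (0 : 'rV[R]_n) = 0.
Proof. by rewrite enormE dot0l sqrtr0. Qed.

Lemma enorm_eq0 u : (enorm u == 0) = (u == 0).
Proof. by rewrite -dot_eq0 -sqr_enorm sqrf_eq0. Qed.

Lemma enormN u : enorm (- u) = enorm u.
Proof. by rewrite !enormE dotNl dotNr opprK. Qed.

Lemma enormZ k u : enorm (k *: u) = `|k| * enorm u.
Proof. by rewrite !enormE dotZl dotZr mulrA -expr2 sqrtrM ?sqr_ge0// sqrtr_sqr. Qed.

Lemma ler_enormD u v : enorm (u + v) <= enorm u + enorm v.
Proof.
rewrite -(ler_pXn2r (n := 2))// ?nnegrE ?addr_ge0 ?enorm_ge0//.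
rewrite sqrrD !sqr_enorm dotDl !dotDr (dotC v u).
suff : dot u v <= enorm u * enorm v by lra.
rewrite !enormE -sqrtrM ?dot_ge0// (le_trans (ler_norm _))// -sqrtr_sqr.
by rewrite ler_wsqrtr// dot_CauchySchwarz.
Qed.

Lemma subr_coord_continuous x0 i : continuous (fun x => (x - x0) 0 i : R).
Proof.
move=> x; rewrite (_ : (fun _ => _) = (fun x => x 0 i - x0 0 i)).
  by apply: continuousB; [exact: coord_continuous|exact: cst_continuous].
by apply/funext => z; rewrite !mxE.
Qed.

Lemma dot_continuousl v x0 : continuous (fun x => dot (x - x0) v).
Proof.
move=> x; apply: continuous_sumr => i; apply: continuousM.
  exact: subr_coord_continuous.
exact: cst_continuous.
Qed.

Lemma dot_continuous x0 : continuous (fun x => dot (x - x0) (x - x0)).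
Proof.
by move=> x; apply: continuous_sumr => i; apply: continuousM;
  exact: subr_coord_continuous.
Qed.

Lemma enorm_continuous x0 : continuous (fun x => enorm (x - x0)).
Proof.
move=> x; rewrite (_ : (fun _ => _) = Num.sqrt \o (fun x => dot (x - x0) (x - x0))).
  by apply: continuous_comp; [exact: dot_continuous|exact: sqrt_continuous].
by apply/funext => z /=; rewrite enormE.
Qed.

End InnerProduct.

(** * Test functions depending on a linear form and on the distance to a point *)

Section PlaneRadial.
Context {R : realType} {n : nat}.
Implicit Types (e x v : 'rV[R]_n) (F G : R -> R).

(** Both derivatives are limits of the same difference quotient, so every directional derivative
    below reduces to one-variable calculus. *)
Lemma is_derive_line (f : 'rV[R]_n -> R) x v (d : R) :
  is_derive (0 : R) 1 (fun h => f (x + h *: v)) d -> is_derive x v f d.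
Proof.
case=> drv val.
have E : (fun h : R => h^-1 *: (f (h *: v + x) - f x)) =
    (fun h : R => h^-1 *: (((fun h => f (x + h *: v)) \o shift 0) (h *: 1) -
      (fun h => f (x + h *: v)) 0)).
  by apply/funext => h /=; rewrite scale0r addr0 addr0 scaler1 [h *: v + x]addrC.
by split; [rewrite /derivable; move: drv; rewrite /derivable -E|
  rewrite -val /derive -E].
Qed.

Lemma is_derive_plane F (dF : R) x x0 e v :
  is_derive (dot (x - x0) e) 1 F dF ->
  is_derive x v (fun z => F (dot (z - x0) e)) (dF * dot v e).
Proof.
move=> FdF; apply: is_derive_line.
have -> : (fun h : R => F (dot (x + h *: v - x0) e)) =
    F \o (fun h => dot (x - x0) e + h * dot v e).
  by apply/funext => h /=; rewrite addrAC (dotDl (x - x0)) dotZl.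
apply: is_derive1_comp; first by rewrite mul0r addr0.
by apply: is_derive_eq; rewrite /GRing.scale/=; ring.
Qed.

Lemma is_derive_radial G (dG : R) x x0 v :
  is_derive (dot (x - x0) (x - x0)) 1 G dG ->
  is_derive x v (fun z => G (dot (z - x0) (z - x0)))
    (2 * dG * dot (x - x0) v).
Proof.
move=> GdG; apply: is_derive_line.
have -> : (fun h : R => G (dot (x + h *: v - x0) (x + h *: v - x0))) =
  G \o (fun h => dot (x - x0) (x - x0) + h * (2 * dot (x - x0) v) +
                 h * h * dot v v).
  apply/funext => h /=; rewrite addrAC; congr G; move: (x - x0) => w.
  by rewrite !(dotDl, dotDr, dotZl, dotZr) (dotC v w); ring.
rewrite [2 * dG]mulrC -mulrA; apply: is_derive1_comp.
  by rewrite !mul0r !addr0.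
apply: is_derive_eq; rewrite /GRing.scale/=; ring.
Qed.

Lemma is_derive_coord x x0 v j :
  is_derive x v (fun z => (z - x0) 0 j : R) (v 0 j).
Proof.
apply: is_derive_line.
have -> : (fun h : R => (x + h *: v - x0) 0 j) = (fun h => (x - x0) 0 j + h * v 0 j).
  by apply/funext => h /=; rewrite !mxE; ring.
by apply: is_derive_eq; rewrite /GRing.scale/=; ring.
Qed.

End PlaneRadial.

Section PlaneRadialTest.
Context {R : realType} {n : nat}.
Variables (c : R) (F F1 F2 G G1 G2 : R -> R) (x0 e : 'rV[R]_n).
Hypotheses (dF : forall t : R, is_derive t 1 F (F1 t))
  (dF1 : forall t : R, is_derive t 1 F1 (F2 t)) (cF2 : continuous F2)
  (dG : forall t : R, is_derive t 1 G (G1 t))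
  (dG1 : forall t : R, is_derive t 1 G1 (G2 t)) (cG2 : continuous G2).

(** Common form of both test functions used below. [G] takes the squared distance, a polynomial, so
    that no smoothness is lost at [x0]. *)
Definition plane_radial (x : 'rV[R]_n) : R :=
  c + F (dot (x - x0) e) + G (dot (x - x0) (x - x0)).

Let t (x : 'rV[R]_n) : R := dot (x - x0) e.
Let q (x : 'rV[R]_n) : R := dot (x - x0) (x - x0).

Lemma is_derive_plane_radial x i :
  is_derive x (delta_mx 0 i) plane_radial
    (F1 (t x) * e 0 i + 2 * G1 (q x) * (x - x0) 0 i).
Proof.
have dFt := is_derive_plane F _ x x0 e (delta_mx 0 i) (dF _).
have dGq := is_derive_radial G _ x x0 (delta_mx 0 i) (dG _).
rewrite /plane_radial; apply: is_derive_eq.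
by rewrite add0r (dotC (delta_mx 0 i)) !dot_delta.
Qed.

Lemma partial_plane_radial i :
  partial i plane_radial =
  (fun x => F1 (t x) * e 0 i + 2 * G1 (q x) * (x - x0) 0 i).
Proof. by apply/funext => x; case: (is_derive_plane_radial x i). Qed.

Lemma is_derive_partial_plane_radial x i j :
  is_derive x (delta_mx 0 i) (partial j plane_radial)
    (F2 (t x) * (e 0 i * e 0 j) + 2 * G1 (q x) * (i == j)%:R +
     4 * G2 (q x) * ((x - x0) 0 i * (x - x0) 0 j)).
Proof.
rewrite partial_plane_radial.
have dF1t := is_derive_plane F1 _ x x0 e (delta_mx 0 i) (dF1 _).
have dG1q := is_derive_radial G1 _ x x0 (delta_mx 0 i) (dG1 _).
have dw := is_derive_coord x x0 (delta_mx 0 i) j.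
apply: is_derive_eq.
rewrite (dotC (delta_mx 0 i)) !dot_delta !mxE eqxx/= [j == i]eq_sym /GRing.scale/=.
rewrite -/(t x) -/(q x); ring.
Qed.

Lemma grad_plane_radial x :
  grad plane_radial x = F1 (t x) *: e + (2 * G1 (q x)) *: (x - x0).
Proof. by apply/rowP => i; rewrite !mxE partial_plane_radial !mxE. Qed.

Lemma hessian_plane_radial x :
  hessian plane_radial x = F2 (t x) *: (e^T *m e) + (2 * G1 (q x))%:M +
    (4 * G2 (q x)) *: ((x - x0)^T *m (x - x0)).
Proof.
apply/matrixP => i j; rewrite !mxE !big_ord1 !mxE.
have [_ ] := is_derive_partial_plane_radial x i j.
rewrite -/(partial i (partial j plane_radial) x) => ->.
by rewrite !mxE mulr_natr.
Qed.

Lemma class_C2_plane_radial (Omega : set 'rV[R]_n) : class_C2 Omega plane_radial.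
Proof.
have c1 (f df : R -> R) : (forall z : R, is_derive z 1 f (df z)) -> continuous f.
  move=> fdf z; apply: differentiable_continuous; apply/derivable1_diffP.
  by case: (fdf z).
have ct : continuous t by move=> x; exact: dot_continuousl.
have cq : continuous q by move=> x; exact: dot_continuous.
have cF : continuous (F \o t).
  by move=> x; apply: continuous_comp; [exact: ct|exact: (c1 _ _ dF)].
have cF1 : continuous (F1 \o t).
  by move=> x; apply: continuous_comp; [exact: ct|exact: (c1 _ _ dF1)].
have cF2t : continuous (F2 \o t).
  by move=> x; apply: continuous_comp; [exact: ct|exact: cF2].
have cG : continuous (G \o q).
  by move=> x; apply: continuous_comp; [exact: cq|exact: (c1 _ _ dG)].
have cG1 : continuous (G1 \o q).
  by move=> x; apply: continuous_comp; [exact: cq|exact: (c1 _ _ dG1)].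
have cG2q : continuous (G2 \o q).
  by move=> x; apply: continuous_comp; [exact: cq|exact: cG2].
have cw i : continuous (fun x : 'rV[R]_n => (x - x0) 0 i).
  exact: subr_coord_continuous.
have cc (k : R) : continuous (fun _ : 'rV[R]_n => k).
  exact: cst_continuous.
have cD (f g : 'rV[R]_n -> R) : continuous f -> continuous g ->
    continuous (fun x => f x + g x).
  by move=> cf cg x; apply: continuousD; [exact: cf|exact: cg].
have cM (f g : 'rV[R]_n -> R) : continuous f -> continuous g ->
    continuous (fun x => f x * g x).
  by move=> cf cg x; apply: continuousM; [exact: cf|exact: cg].
split.
- by move=> x _; exact: (cD _ _ (cD _ _ (cc c) cF) cG).
- move=> i; split=> [x _|x _]; first by case: (is_derive_plane_radial x i).
  rewrite partial_plane_radial.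
  exact: (cD _ _ (cM _ _ cF1 (cc _)) (cM _ _ (cM _ _ (cc _) cG1) (cw i))).
- move=> i j; split=> [x _|x _].
    by case: (is_derive_partial_plane_radial x i j).
  rewrite (_ : partial i _ = (fun x => F2 (t x) * (e 0 i * e 0 j) +
     2 * G1 (q x) * (i == j)%:R +
     4 * G2 (q x) * ((x - x0) 0 i * (x - x0) 0 j))); last first.
    by apply/funext => z; case: (is_derive_partial_plane_radial z i j).
  exact: (cD _ _ (cD _ _ (cM _ _ cF2t (cc _))
    (cM _ _ (cM _ _ (cc _) cG1) (cc _)))
    (cM _ _ (cM _ _ (cc _) cG2q) (cM _ _ (cw i) (cw j)))).
Qed.

End PlaneRadialTest.

Arguments class_C2_plane_radial {R n} c {F F1 F2 G G1 G2} x0 e.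
Arguments grad_plane_radial {R n} c {F F1 G G1} x0 e.
Arguments hessian_plane_radial {R n} c {F F1 F2 G G1 G2} x0 e.

(** * The operator near a point: continuity, and the limit in the definition for negative [gamma] *)

Section PLaplaceOperator.
Context {R : realType} {n : nat}.
Implicit Types (u v e x : 'rV[R]_n) (phi : 'rV[R]_n -> R).

Lemma mulmx_trE u v : (u *m v^T) 0 0 = dot u v.
Proof. by rewrite mxE; apply: eq_bigr => i _; rewrite mxE. Qed.

Lemma mxtrace_trmul u v : \tr (u^T *m v) = dot u v.
Proof. by rewrite mxtrace_mulC trace_mx11 mulmx_trE dotC. Qed.

Lemma normr_le_enorm v : `|v| <= enorm v.
Proof.
rewrite [`|v|]mx_normrE; apply: bigmax_le => [|[i j] _ /=]; first exact: enorm_ge0.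
rewrite (ord1 i) -(ler_pXn2r (n := 2))// ?nnegrE ?enorm_ge0//.
rewrite real_normK ?num_real// sqr_enorm /dot (bigD1 j)//= -expr2 lerDl.
by apply: sumr_ge0 => k _; rewrite -expr2 sqr_ge0.
Qed.

(** The sup norm is at most [enorm], so a Euclidean ball lies in the cube of the same radius. *)
Lemma nbhs_eball x (P : set 'rV[R]_n) :
  nbhs x P -> exists2 d, 0 < d & eball x d `<=` P.
Proof.
move=> /nbhs_ballP[d /= d0 dP]; exists d => // z xz; apply: dP.
rewrite -ball_normE/= distrC; exact: le_lt_trans (normr_le_enorm _) xz.
Qed.

Lemma pLaplace_op_continuous (p gamma : R) Omega phi x :
  class_C2 Omega phi -> Omega x -> grad phi x != 0 ->
  {for x, continuous (pLaplace_op p gamma phi)}.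
Proof.
move=> [_ c1 c2] /mem_set Ox g0.
pose N z := enorm (grad phi z).
have N0 : 0 < N x by rewrite lt_neqAle eq_sym enorm_eq0 g0 enorm_ge0.
have cN : {for x, continuous N}.
  rewrite /N (_ : (fun _ => _) =
    Num.sqrt \o (fun z => \sum_(i < n) partial i phi z * partial i phi z)).
    apply: continuous_comp; last exact: sqrt_continuous.
    by apply: continuous_sumr => i; apply: continuousM; exact: (c1 i).2.
  apply/funext => z; rewrite enormE/=; congr Num.sqrt.
  by apply: eq_bigr => i _; rewrite !mxE.
(* In coordinates the operator is built from continuous first and second partial derivatives and
   from [N], whose power and inverse are continuous at [x] because [N x > 0]. *)
rewrite (_ : pLaplace_op p gamma phi = (fun z => N z `^ gamma *
  (\sum_(i < n) partial i (partial i phi) z +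
  ((p - 2) * ((N z)^-1 * (N z)^-1)) * (\sum_(j < n) \sum_(i < n)
    partial i phi z * partial i (partial j phi) z * partial j phi z)))); last first.
  apply/funext => z; rewrite /pLaplace_op /normalized_pLaplacian -/(N z).
  congr (_ * (_ + _)); first by apply: eq_bigr => i _; rewrite mxE.
  rewrite -mulrA; congr (_ * _); rewrite -!scalemxAl [(_ *: _)^T]linearZ /= -scalemxAr scalerA mxE.
  congr (_ * _); rewrite mxE; apply: eq_bigr => j _.
  by rewrite !mxE mulr_suml; apply: eq_bigr => i _; rewrite !mxE.
have cNV : {for x, continuous (fun z => (N z)^-1)}.
  exact: (continuousV (lt0r_neq0 N0) cN).
apply: continuousM; first exact: continuous_powR.
apply: continuousD; first by apply: continuous_sumr => i; exact: (c2 i i).2.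
apply: continuousM.
  apply: continuousM; first exact: cst_continuous.
  exact: continuousM.
apply: continuous_sumr => j; apply: continuous_sumr => i.
apply: continuousM; last exact: (c1 j).2.
by apply: continuousM; [exact: (c1 i).2|exact: (c2 i j).2].
Qed.

(** The infimum over the punctured ball does not increase with [r], so its limit exists, and a lower
    bound valid for all small [r] passes to that limit. *)
Lemma lim_neg_op_values_ge (p gamma K : R) phi x :
  (\forall z \near x, z <> x -> pLaplace_op p gamma phi z <= K) ->
  ((- K)%:E <= lim (ereal_inf (neg_op_values p gamma phi x r) @[r --> 0^'+]))%E.
Proof.
move=> /nbhs_eball[d d0 dP]; apply: lime_ge.
  apply: nonincreasing_at_right_is_cvge; near=> b => r s _ _ rs.
  apply: ereal_inf_le_tmp => _ [z [zr zx] <-]; exists z => //; split=> //.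
  exact: lt_le_trans zr rs.
near=> r; apply: le_ereal_inf_tmp => _ [z [zr zx] <-].
rewrite lee_fin lerN2; apply: dP => //; rewrite /eball/=.
apply: lt_le_trans zr _; near: r; exact: nbhs_right_le.
Unshelve. all: by end_near. Qed.

End PLaplaceOperator.

(** * The barrier away from its centre *)

Section OneVariable.
Context {R : realType}.

(** Mean value theorem: the derivative is continuous at [r], so the factor [th > 1] absorbs its
    variation nearby, whatever the sign of [g - 1]. *)
Lemma powR_sub_near (g r th : R) : 0 < g -> 0 < r -> 1 < th ->
  exists2 d, 0 < d & forall a s, r - d < a -> a <= s -> s < r + d ->
    s `^ g - a `^ g <= th * (g * r `^ (g - 1)) * (s - a).
Proof.
move=> g0 r0 th1.
have [d /= d0 dP] : exists2 d, 0 < d & forall x, `|r - x| < d ->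
    0 < x /\ x `^ (g - 1) <= th * r `^ (g - 1).
  suff /nbhs_ballP[d d0 dP] : \forall x \near r,
      0 < x /\ x `^ (g - 1) <= th * r `^ (g - 1) by exists d.
  near=> x; split; first by near: x; exact: lt_nbhsr.
  apply: ltW; near: x; apply: (cvgr_lt (r `^ (g - 1))).
    exact: powR_continuous_at.
  by rewrite ltr_pMl ?powR_gt0.
exists d => // a s ra as_ sr.
have xP x : a <= x <= s -> 0 < x /\ x `^ (g - 1) <= th * r `^ (g - 1).
  by move=> /andP[ax xs]; apply: dP; rewrite ltr_norml; lra.
have dg x : x \in `]a, s[ -> is_derive x 1 (fun y => y `^ g) (g * x `^ (g - 1)).
  rewrite in_itv/= => /andP[ax xs]; apply: is_derive1_powR.
  by case: (xP x); rewrite ?(ltW ax) ?(ltW xs).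
have [|x] := MVT_segment as_ dg.
  apply: continuous_in_subspaceT => x; rewrite inE/= in_itv/= => /xP[x0 _].
  exact: powR_continuous_at.
rewrite in_itv/= => /xP[_ xg] ->; apply: ler_wpM2r; first by rewrite subr_ge0.
by rewrite mulrCA ler_pM2l.
Unshelve. all: by end_near. Qed.

Lemma powR1D_le_expR (k b x : R) : 0 <= k -> k <= b -> 0 <= x ->
  (1 + x) `^ k <= expR (b * x).
Proof.
move=> k0 kb x0; rewrite /powR gt_eqF ?ltr_wpDr// ler_expR.
by apply: ler_pM => //; [rewrite ln_ge0// lerDl|rewrite le_ln1Dx//; lra].
Qed.

(** Rests on [ln (1 + x) >= x / (1 + x)], which is [ln (1 + y) <= y] at [y = - x / (1 + x)].
    Together with the previous lemma it gives the sign of a derivative on either side of 0. *)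
Lemma expR_le_powR1D (k b x : R) : 0 <= k -> -1 < x -> x <= 0 ->
  k <= b * (1 + x) -> expR (b * x) <= (1 + x) `^ k.
Proof.
move=> k0 x1 x0 kb; have x1_gt0 : 0 < 1 + x by lra.
rewrite /powR gt_eqF// ler_expR.
have : ln (1 + - (x / (1 + x))) <= - (x / (1 + x)).
  apply: le_ln1Dx; rewrite ltrN2 ltr_pdivrMr//; lra.
have -> : 1 + - (x / (1 + x)) = (1 + x)^-1 by field; rewrite gt_eqF.
rewrite lnV ?posrE// lerN2 => lnx.
apply: le_trans (ler_wpM2l k0 lnx).
rewrite -(ler_pM2r x1_gt0) mulrA divfK ?gt_eqF//; nra.
Qed.

(* The right-hand side has the same value and slope at 0 and, since
   [b > beta - 1], a larger second derivative. *)
Lemma powR1D_le_exp_near (beta b : R) : 1 < beta -> beta - 1 < b ->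
  exists2 d, 0 < d & forall x, `|x| < d ->
    (1 + x) `^ beta <= 1 + beta / b * (expR (b * x) - 1).
Proof.
move=> beta1 bb; have b0 : 0 < b by lra.
have k0 : 0 <= beta - 1 by lra.
pose f x : R := beta / b * expR (b * x) - (1 + x) `^ beta.
pose df x : R := beta * (expR (b * x) - (1 + x) `^ (beta - 1)).
(* For [x > - d] one has [beta - 1 <= b * (1 + x)], the condition of [expR_le_powR1D]; moreover
   [d < 1] keeps [1 + x] positive. *)
pose d := 1 - (beta - 1) / b.
have d0 : 0 < d by rewrite /d subr_gt0 ltr_pdivrMr ?mul1r.
have d1 : d < 1 by rewrite /d ltrBlDr ltrDl divr_gt0//; lra.
have dfP x : - d < x -> is_derive x 1 f (df x).
  move=> dx; have x1 : 0 < 1 + x by lra.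
  have := is_derive1_powR beta x1 => dp.
  have h : is_derive x 1 (fun y : R => 1 + y) 1.
    by apply: is_derive_eq; ring.
  have hb : is_derive x 1 (fun y : R => b * y) b.
    by apply: is_derive_eq; rewrite /GRing.scale/=; ring.
  have dp1 := is_derive1_comp dp h.
  have de := is_derive1_comp (is_derive_expR (b * x)) hb.
  have -> : f = (fun y => beta / b * (expR \o (fun y => b * y)) y -
    ((fun y => y `^ beta) \o (fun y => 1 + y)) y) by [].
  by apply: is_derive_eq; rewrite /df /GRing.scale/=; field; rewrite gt_eqF.
have cf x : - d < x -> {for x, continuous f}.
  move=> /dfP[+ _]; move/derivable1_diffP; exact: differentiable_continuous.
have f0 : f 0 = beta / b - 1 by rewrite /f mulr0 expR0 addr0 powR1 mulr1.
have key x y : - d < x -> x <= y -> exists2 c, x <= c <= y &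
    f y - f x = df c * (y - x).
  move=> dx xy; have [c||c] := @MVT_segment _ f df _ _ xy.
  - by rewrite in_itv/= => /andP[xc _]; apply: dfP; lra.
  - apply: continuous_in_subspaceT => c; rewrite inE/= in_itv/= => /andP[xc _].
    by apply: cf; lra.
  - by rewrite in_itv/=; exists c.
(* It is enough that [f] has a minimum at 0: [df] is non-negative to the right of 0 and non-positive
   to the left. *)
suff fP x : `|x| < d -> f 0 <= f x.
  exists d => // x /fP; rewrite f0 /f => fx.
  by rewrite mulrBr mulr1; lra.
rewrite ltr_norml => /andP[dx xd]; have [x0|x0] := leP 0 x.
  have [|c /andP[c0 _] fx] := key _ _ _ x0; first by lra.
  rewrite -subr_ge0 fx mulr_ge0 ?subr_ge0// mulr_ge0//; first by lra.
  by rewrite subr_ge0 powR1D_le_expR//; lra.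
have [c /andP[xc c0] fx] := key _ _ dx (ltW x0).
rewrite -subr_le0 fx mulr_le0_ge0//; last by lra.
rewrite mulr_ge0_le0//; first by lra.
rewrite subr_le0 expR_le_powR1D//; first by lra.
have bd : b * d = b - (beta - 1) by rewrite /d; field; rewrite gt_eqF.
by have := ler_wpM2l (ltW b0) (le_trans (ltW dx) xc); lra.
Qed.

End OneVariable.

(** * A smooth test function without critical points that dominates the barrier near [x0] *)

Section TestFunction.
Context {R : realType} {n : nat}.
Implicit Types (e x z : 'rV[R]_n) (u phi : 'rV[R]_n -> R).

Lemma sqr_powR (x g : R) : 0 <= x -> (x ^+ 2) `^ (g / 2) = x `^ g.
Proof.
by move=> x0; rewrite -powR_mulrn// -powRrM mulrC divfK ?pnatr_eq0.
Qed.

(** With [t] the coordinate along the axis from [z] through [x0], Pythagoras splits the squared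
    distance to [z] into [(rho + t x) ^+ 2] and a transverse part. The axial factor is bounded by an
    exponential; the transverse increment is bounded through the power [beta / 2] of squared
    distances. The slack [th] pays for the higher-order terms of both. *)
Lemma enorm_powR_le_near z x0 (beta th : R) :
  x0 != z -> 1 < beta -> 1 < th ->
  let rho := enorm (x0 - z) in
  let t x := dot (x - x0) (rho^-1 *: (x0 - z)) in
  let b := th * (beta - 1) in
  \forall x \near x0, enorm (x - z) `^ beta <=
    rho `^ beta * (1 + beta / b * (expR (b / rho * t x) - 1)) +
    th * (beta / 2 * rho `^ (beta - 2)) * (dot (x - x0) (x - x0) - t x ^+ 2).
Proof.
move=> x0z beta1 th1 rho t b; set e := rho^-1 *: (x0 - z) in t *.
have rho0 : 0 < rho by rewrite lt_neqAle eq_sym enorm_eq0 subr_eq0 x0z enorm_ge0.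
have de : rho *: e = x0 - z by rewrite /e scalerA divff ?scale1r ?gt_eqF.
have e1 : dot e e = 1.
  by rewrite /e dotZl dotZr -sqr_enorm -/rho; field; rewrite gt_eqF.
clearbody e; have bb : beta - 1 < b by rewrite ltr_pMl//; lra.
have beta20 : 0 < beta / 2 by lra.
have rho20 : 0 < rho ^+ 2 by rewrite exprn_gt0.
have [d1 d10 P1] := powR_sub_near _ _ _ beta20 rho20 th1.
have [d2 d20 P2] := powR1D_le_exp_near _ _ beta1 bb.
have ct : t x @[x --> x0] --> (0 : R).
  by rewrite -(dot0l e) -(subrr x0); exact: dot_continuousl.
have cS : dot (x - z) (x - z) @[x --> x0] --> rho ^+ 2.
  by rewrite /rho sqr_enorm; exact: dot_continuous.
have cT : (rho + t x) ^+ 2 @[x --> x0] --> rho ^+ 2.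
  have crt : {for x0, continuous (fun x => rho + t x)}.
    by apply: continuousD; [exact: cst_continuous|exact: dot_continuousl].
  have : (rho + t x) * (rho + t x) @[x --> x0] --> (rho + t x0) * (rho + t x0).
    exact: (cvgM crt crt).
  have -> : t x0 = 0 by rewrite /t subrr dot0l.
  by rewrite addr0.
near=> x.
have SE : dot (x - z) (x - z) - (rho + t x) ^+ 2 = dot (x - x0) (x - x0) - t x ^+ 2.
  have -> : x - z = (x - x0) + rho *: e by rewrite de addrA subrK.
  rewrite /t; move: (x - x0) => w.
  by rewrite !(dotDl, dotDr, dotZl, dotZr) (dotC e w) e1; ring.
have tq : t x ^+ 2 <= dot (x - x0) (x - x0).
  by have := dot_CauchySchwarz (x - x0) e; rewrite e1 mulr1.
(* The bound [d2] is for the exponential comparison, the bound 1 for [rho + t x > 0]. *)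
have tx : `|t x| < rho * Num.min d2 1.
  near: x; apply: cvgr_norm_lt ct _ _; rewrite normr0 mulr_gt0//.
  by rewrite lt_min d20 ltr01.
have /P2 tb : `|t x / rho| < d2.
  rewrite normrM normfV (gtr0_norm rho0) ltr_pdivrMr// mulrC.
  apply: lt_le_trans tx _; rewrite ler_pM2l// ge_min lexx//.
have rt0 : 0 < rho + t x.
  have : `|t x| < rho.
    by apply: lt_le_trans tx _; rewrite ger_pMr// ge_min lexx orbT.
  by rewrite ltr_norml; lra.
have rtE : (rho + t x) `^ beta = rho `^ beta * (1 + t x / rho) `^ beta.
  rewrite -powRM//; first by congr powR; field; rewrite gt_eqF.
    exact: ltW.
  rewrite -(pmulr_rge0 _ rho0) mulrDr mulr1 mulrCA divff ?gt_eqF// mulr1.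
  exact: ltW.
rewrite -(sqr_powR (enorm (x - z))) ?enorm_ge0// sqr_enorm.
have -> : b / rho * t x = b * (t x / rho) by rewrite mulrAC mulrA.
apply: le_trans (lerD (ler_wpM2l (powR_ge0 rho beta) tb) (lexx _)).
rewrite -rtE -lerBlDl.
rewrite -SE -(sqr_powR (rho + t x)) ?(ltW rt0)//.
have -> : rho `^ (beta - 2) = (rho ^+ 2) `^ (beta / 2 - 1).
  rewrite -[X in _ `^ X](divfK (_ : 2 != 0 :> R)) ?pnatr_eq0//.
  by rewrite -(sqr_powR rho) ?(ltW rho0)//; congr powR; field.
apply: P1.
- by near: x; apply: cvgr_gt cT _ _; lra.
- by rewrite -subr_ge0 SE subr_ge0.
- by near: x; apply: cvgr_lt cS _ _; lra.
Unshelve. all: by end_near. Qed.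

Variables (c A B k : R) (x0 e : 'rV[R]_n).

(** For a unit vector [e], the two terms in [k] combine to [k / 2] times the squared distance to the
    line through [x0] along [e]. The exponential carries the dependence along that line. *)
Definition exp_test : 'rV[R]_n -> R :=
  plane_radial c (fun t : R => A * expR (B * t) - k / 2 * (t * t)) (fun s : R => k / 2 * s)
    x0 e.

Let F1 (t : R) := A * B * expR (B * t) - k * t.
Let F2 (t : R) := A * B * B * expR (B * t) - k.

Let dE (t : R) : is_derive t 1 (fun y : R => expR (B * y)) (B * expR (B * t)).
Proof.
have hb : is_derive t 1 (fun y : R => B * y) B.
  by apply: is_derive_eq; rewrite /GRing.scale/=; ring.
by have := is_derive1_comp (is_derive_expR (B * t)) hb; rewrite mulrC.
Qed.

Let dF (t : R) :
  is_derive t 1 (fun t : R => A * expR (B * t) - k / 2 * (t * t)) (F1 t).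
Proof.
have := dE t => dEt.
by apply: is_derive_eq; rewrite /F1 /GRing.scale/=; field.
Qed.

Let dF1 (t : R) : is_derive t 1 F1 (F2 t).
Proof.
have := dE t => dEt.
by apply: is_derive_eq; rewrite /F2 /GRing.scale/=; ring.
Qed.

Let cF2 : continuous F2.
Proof.
move=> t; have := dE t => dEt; apply/differentiable_continuous/derivable1_diffP.
rewrite /F2; exact: ex_derive.
Qed.

Let dG (t : R) : is_derive t 1 (fun s : R => k / 2 * s) (k / 2).
Proof. by apply: is_derive_eq; rewrite /GRing.scale/=; ring. Qed.

Let dG1 (t : R) : is_derive t 1 (fun _ : R => k / 2) 0.
Proof. exact: is_derive_cst. Qed.

Lemma class_C2_exp_test Omega : class_C2 Omega exp_test.
Proof.
apply: (class_C2_plane_radial c x0 e dF dF1 cF2 dG dG1) => t.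
exact: cst_continuous.
Qed.

Hypotheses (e1 : dot e e = 1) (AB0 : 0 < A * B).

(** In the component of the gradient along [e] the terms in [k] cancel, leaving the positive number
    [A * B * expR (B * t)], where [t] is the coordinate along [e]. *)
Lemma grad_exp_test_neq0 x : grad exp_test x != 0.
Proof.
rewrite (grad_plane_radial c x0 e dF dG) /F1; move: (x - x0) => w.
apply/eqP => /(congr1 (fun v => dot v e)).
rewrite dot0l dotDl !dotZl e1 => /eqP; apply/negP; rewrite gt_eqF//.
rewrite mulr1 [2 * _]mulrC divfK ?pnatr_eq0// subrK.
by rewrite mulr_gt0// expR_gt0.
Qed.

(** At [x0] the gradient is [A * B] times [e]. The Hessian acts as [A * B * B] along [e], which gets
    the weight [p - 1], and as [k] on the orthogonal complement, of dimension [n - 1]. *)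
Lemma pLaplace_op_exp_test (p gamma : R) :
  pLaplace_op p gamma exp_test x0 =
    (A * B) `^ gamma * ((p - 1) * (A * B * B) + (n%:R - 1) * k).
Proof.
have gE : grad exp_test x0 = (A * B) *: e.
  rewrite (grad_plane_radial c x0 e dF dG) subrr scaler0 addr0.
  by rewrite dot0l /F1 !mulr0 expR0 mulr1 subr0.
have hE : hessian exp_test x0 = (A * B * B - k) *: (e^T *m e) + k%:M.
  rewrite (hessian_plane_radial c x0 e dF dF1 dG dG1).
  rewrite subrr mulr0 scale0r addr0 dot0l /F2 mulr0 expR0 mulr1.
  by rewrite [2 * _]mulrC divfK ?pnatr_eq0.
have ee : enorm e = 1 by rewrite enormE e1 sqrtr1.
rewrite /pLaplace_op /normalized_pLaplacian /laplacian gE hE enormZ ee mulr1.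
rewrite gtr0_norm// scalerA mulVf ?gt_eqF// scale1r; congr (_ * _).
rewrite mxtraceD mxtraceZ mxtrace_trmul e1 mxtrace_scalar.
rewrite mulmxDr mulmxDl mul_mx_scalar -scalemxAr -!scalemxAl mulmxA.
have -> : e *m e^T = 1%:M by rewrite [LHS]mx11_scalar mulmx_trE e1.
rewrite mul1mx [e *m e^T]mx11_scalar mulmx_trE e1 !mxE eqxx !mulr1n -[k *+ n]mulr_natr; ring.
Qed.

End TestFunction.

(** * Comparison of a subsolution with the barrier away from the centre *)

Section Subsolution.
Context {R : realType} {n : nat}.
Implicit Types (x z : 'rV[R]_n) (u phi : 'rV[R]_n -> R).

(** For test functions without critical points both definitions yield the pointwise inequality: when
    [gamma < 0] the operator is continuous at [x], so the limit of infima cannot differ from its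
    value there. *)
Lemma visc_subsolution_op_ge (p gamma : R) f Omega u phi x :
  visc_subsolution p gamma f Omega u -> class_C2 Omega phi -> Omega x ->
  touches_from_above phi u x -> (forall z, grad phi z != 0) ->
  f x (phi x) <= pLaplace_op p gamma phi x.
Proof.
rewrite /visc_subsolution; case: ifP => _ hu c2 Ox ta g0.
  by have [+ _] := hu _ _ c2 Ox ta; apply; exact: g0.
rewrite leNgt; apply/negP => opf.
have := hu _ _ c2 Ox ta (fun z _ _ => g0 z); apply/negP; rewrite -ltNge.
(* The midpoint of the gap: the operator stays below [K] near [x], while [- K] is still above
   [- f x (phi x)]. *)
pose K := (pLaplace_op p gamma phi x + f x (phi x)) / 2.
apply: (@lt_le_trans _ _ (- K)%:E); first by rewrite lte_fin /K; lra.
apply: lim_neg_op_values_ge.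
have cop := pLaplace_op_continuous p gamma _ _ _ c2 Ox (g0 x).
have : \forall z \near x, pLaplace_op p gamma phi z < K.
  by apply: (cvgr_lt _ cop); rewrite /K; lra.
by apply: filterS => z /ltW.
Qed.

Lemma exists_gt1_mul_lt (r s : R) : 0 < r -> r < s -> exists2 th, 1 < th & th * r < s.
Proof.
move=> r0 rs; exists ((r + s) / (2 * r)).
  by rewrite ltr_pdivlMr ?mulr_gt0//; lra.
have -> : (r + s) / (2 * r) * r = (r + s) / 2 by field; rewrite gt_eqF.
lra.
Qed.

Lemma beta_exp_gt1 (gamma m : R) : 0 <= m -> m < gamma + 1 ->
  1 < beta_exp gamma m.
Proof. by move=> m0 mg; rewrite /beta_exp ltr_pdivlMr; lra. Qed.

(** This identity fixes the choice of [beta]: the left side is the degree of the operator applied to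
    a function of degree [beta], the right side the degree of its [m]-th power. *)
Lemma beta_expM (gamma m : R) : m < gamma + 1 ->
  (beta_exp gamma m - 1) * (gamma + 1) - 1 = beta_exp gamma m * m.
Proof. by move=> mg; rewrite /beta_exp; field; lra. Qed.

(* [enorm (x - z) `^ beta] has a critical point at [z], which is not allowed for
   test functions when [gamma < 0]; it is replaced by a function without critical
   points and with almost the same second-order jet at [x0]. *)
Lemma subsolution_no_touching (p gamma m lambda0 C : R) (a u : 'rV[R]_n -> R)
    Omega z x0 :
  let beta := beta_exp gamma m in
  (0 < n)%N -> 1 < p -> 0 <= m -> m < gamma + 1 -> 0 < C ->
  C `^ (gamma + 1 - m) * (beta `^ (gamma + 1) *
    (n%:R - 1 + (p - 1) * (beta - 1))) < lambda0 ->
  visc_subsolution p gamma (absorption a m) Omega u ->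
  Omega x0 -> lambda0 <= a x0 -> x0 != z ->
  C * enorm (x0 - z) `^ beta <= u x0 ->
  ~ \forall x \near x0, u x - C * enorm (x - z) `^ beta <=
                        u x0 - C * enorm (x0 - z) `^ beta.
Proof.
move=> beta n0 p1 m0 mg C0 Clam hu Ox lax x0z Cu umax.
have beta1 : 1 < beta by exact: beta_exp_gt1.
have betaE : (beta - 1) * (gamma + 1) - 1 = beta * m by exact: beta_expM.
clearbody beta; have beta0 : 0 < beta by lra.
pose D := n%:R - 1 + (p - 1) * (beta - 1).
have D0 : 0 < D.
  rewrite ltr_wpDl ?subr_ge0 ?ler1n// mulr_gt0 ?subr_gt0//.
pose Y := C `^ (gamma + 1 - m) * (beta `^ (gamma + 1) * D).
have Y0 : 0 < Y by rewrite !mulr_gt0// powR_gt0//; lra.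
have [th th1 thY] : exists2 th, 1 < th & th * Y < lambda0.
  exact: exists_gt1_mul_lt.
have := enorm_powR_le_near _ _ _ _ x0z beta1 th1.
set rho := enorm (x0 - z); set e := rho^-1 *: (x0 - z); set b := th * (beta - 1).
move=> /= touch.
have rho0 : 0 < rho by rewrite lt_neqAle eq_sym enorm_eq0 subr_eq0 x0z enorm_ge0.
have e1 : dot e e = 1.
  by rewrite /e dotZl dotZr -sqr_enorm -/rho; field; rewrite gt_eqF.
have b0 : 0 < b by rewrite mulr_gt0//; lra.
(* [A], [B] and [k] are read off from [C] times the bound of [enorm_powR_le_near]. Then [A * B] is
   the slope of the barrier at [x0], while [A * B * B] and [k] are [th] times its radial and
   tangential second derivatives. *)
pose A := C * (rho `^ beta * (beta / b)).
pose B := b / rho.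
pose k := C * (th * (beta * rho `^ (beta - 2))).
have rb0 g : 0 < rho `^ g by rewrite powR_gt0.
have rhoB g : rho `^ g / rho = rho `^ (g - 1).
  by rewrite powRB ?(gt_eqF rho0) ?implybT// powRr1// ltW.
have ABE : A * B = C * beta * rho `^ (beta - 1).
  by rewrite -rhoB /A /B; field; rewrite !gt_eqF.
have ABBE : A * B * B = C * beta * b * rho `^ (beta - 2).
  rewrite (_ : beta - 2 = beta - 1 - 1); last by lra.
  by rewrite -!rhoB /A /B; field; rewrite !gt_eqF.
have AB0 : 0 < A * B by rewrite ABE !mulr_gt0//; lra.
pose phi := exp_test (u x0 - A) A B k x0 e.
have phix0 : phi x0 = u x0.
  by rewrite /phi /exp_test /plane_radial subrr !dot0l !mulr0 expR0; ring.
have ta : touches_from_above phi u x0.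
  split=> //; rewrite phix0 subrr; apply: filterS2 umax touch => x ux tx.
  have := ler_wpM2l (ltW C0) tx; rewrite -/rho in ux.
  rewrite /phi /exp_test /plane_radial -/B.
  set t := dot (x - x0) e; set q := dot _ (x - x0); set E := expR _.
  rewrite subr_le0; have -> : C * (rho `^ beta * (1 + beta / b * (E - 1)) +
      th * (beta / 2 * rho `^ (beta - 2)) * (q - t ^+ 2)) =
    C * rho `^ beta + A * (E - 1) + k / 2 * (q - t ^+ 2).
    by rewrite /A /k; field; rewrite gt_eqF.
  move=> h; lra.
have := visc_subsolution_op_ge _ _ _ _ _ _ _ hu (class_C2_exp_test _ _ _ _ _ _ Omega)
  Ox ta (grad_exp_test_neq0 _ _ _ _ _ _ e1 AB0).
rewrite (pLaplace_op_exp_test _ _ _ _ _ _ e1 AB0) -/phi phix0; apply/negP; rewrite -ltNge.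
rewrite /absorption.
have ux0 : 0 <= u x0 by apply: le_trans Cu; rewrite mulr_ge0 ?powR_ge0 ?ltW.
(* The operator equals [th * Y * (C * rho]^ beta) [^ m], and [th * Y < lambda0 <= a x0]. The
   assumption that the barrier is at most [u] at [x0] and [m >= 0] then give the contradiction. *)
rewrite max_l//; apply: (@lt_le_trans _ _ (lambda0 * (C * rho `^ beta) `^ m)).
  rewrite [(C * _) `^ m]powRM ?powR_ge0 ?(ltW C0)// -powRrM.
  have -> : (A * B) `^ gamma * ((p - 1) * (A * B * B) + (n%:R - 1) * k) =
      th * Y * (C `^ m * rho `^ (beta * m)).
    rewrite ABBE /k ABE /b.
    rewrite -betaE !powRM ?powR_ge0 ?mulr_ge0 ?(ltW C0) ?(ltW beta0)//.
    rewrite -powRrM.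
    have -> : (beta - 1) * (gamma + 1) - 1 = (beta - 1) * gamma + (beta - 2) by ring.
    rewrite [rho `^ (_ * gamma + _)]powRD ?(gt_eqF rho0) ?implybT//.
    rewrite /Y powRB ?(gt_eqF C0) ?implybT//.
    rewrite [C `^ (gamma + 1)]powRD ?(gt_eqF C0) ?implybT//.
    rewrite [beta `^ (gamma + 1)]powRD ?(gt_eqF beta0) ?implybT//.
    rewrite !powRr1 ?(ltW C0) ?(ltW beta0)//.
    by rewrite /D; field; rewrite gt_eqF// powR_gt0.
  by rewrite ltr_pM2r// mulr_gt0// powR_gt0.
apply: ler_pM => //; rewrite ?powR_ge0//.
- by apply: le_trans (ltW thY); rewrite mulr_ge0// ltW//; lra.
- by rewrite ge0_ler_powR// nnegrE mulr_ge0 ?powR_ge0// ltW.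
Qed.

End Subsolution.

(** * Locally constant subsolutions *)

Section LocallyConstant.
Context {R : realType} {n : nat}.
Implicit Types (x y z : 'rV[R]_n) (u : 'rV[R]_n -> R).

Lemma eigenvalue0_set : (0 < n)%N ->
  [set l | eigenvalue (0 : 'M[R]_n) l] = [set 0].
Proof.
move=> n0; apply/seteqP; split=> [l /eigenvalueP[v]|_ ->].
  by rewrite mulmx0 => /esym/eqP; rewrite scaler_eq0 => /orP[/eqP//|->].
apply/eigenvalueP; exists (const_mx 1); first by rewrite mulmx0 scale0r.
apply/eqP => /rowP /(_ (Ordinal n0)); rewrite !mxE; apply/eqP; exact: oner_neq0.
Qed.

(** This is [c] plus the distance to [z] to the power [2 * k + 4]: a polynomial whose gradient
    vanishes only at [z], and whose Hessian vanishes there too. *)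
Definition power_test (c : R) (k : nat) z : 'rV[R]_n -> R :=
  plane_radial c (fun _ => 0) (fun s : R => s ^+ k.+2) z 0.

Section PowerTest.
Variables (c : R) (k : nat) (z : 'rV[R]_n).

Let G1 (s : R) := k.+2%:R * s ^+ k.+1.
Let G2 (s : R) := k.+2%:R * (k.+1%:R * s ^+ k).

Let d0 (t : R) : is_derive t 1 (fun _ : R => 0 : R) 0.
Proof. exact: is_derive_cst. Qed.

Let dX (j : nat) (s : R) : is_derive s 1 (fun s : R => s ^+ j.+1) (j.+1%:R * s ^+ j).
Proof. by split; [exact: exprn_derivable|rewrite exp_derive scaler1]. Qed.

Let dG (s : R) : is_derive s 1 (fun s : R => s ^+ k.+2) (G1 s).
Proof. exact: dX. Qed.

Let dG1 (s : R) : is_derive s 1 G1 (G2 s).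
Proof.
have := dX k s => dXk; apply: is_derive_eq.
by rewrite /G2 /GRing.scale/=; ring.
Qed.

Let c0 : continuous (fun _ : R => 0 : R).
Proof. by move=> t; exact: cst_continuous. Qed.

Let cG2 : continuous G2.
Proof.
have -> : G2 = (fun s => k.+2%:R * k.+1%:R * s ^+ k).
  by apply/funext => s; rewrite /G2 mulrA.
move=> s; apply: (@continuousM _ R (fun=> _) (fun s => s ^+ k)).
  exact: cst_continuous.
exact: exprn_continuous.
Qed.

Lemma class_C2_power_test Omega : class_C2 Omega (power_test c k z).
Proof. exact: (class_C2_plane_radial c z 0 d0 d0 c0 dG dG1 cG2). Qed.

Lemma grad_power_test x :
  grad (power_test c k z) x = (2 * G1 (dot (x - z) (x - z))) *: (x - z).
Proof. by rewrite (grad_plane_radial c z 0 d0 dG) scale0r add0r. Qed.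

Lemma hessian_power_test x :
  hessian (power_test c k z) x = (2 * G1 (dot (x - z) (x - z)))%:M +
    (4 * G2 (dot (x - z) (x - z))) *: ((x - z)^T *m (x - z)).
Proof. by rewrite (hessian_plane_radial c z 0 d0 d0 dG dG1) scale0r add0r. Qed.

(** For a radial power of degree [N = 2 * k + 4] and distance [r], the Hessian has the eigenvalue
    [N * (N - 1) * r ^+ (N - 2)] radially and [N * r ^+ (N - 2)] tangentially, and the gradient has
    length [N * r ^+ (N - 1)]. *)
Lemma pLaplace_op_power_test (p gamma : R) x : x != z ->
  pLaplace_op p gamma (power_test c k z) x =
    (2 * k.+2%:R) `^ gamma *
    (2 * k.+2%:R * (n%:R - 1 + (p - 1) * (2 * k.+1%:R + 1))) *
    enorm (x - z) `^ ((2 * k%:R + 3) * gamma + (2 * k%:R + 2)).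
Proof.
move=> xz; rewrite /pLaplace_op /normalized_pLaplacian /laplacian.
rewrite grad_power_test hessian_power_test.
have : x - z != 0 by rewrite subr_eq0.
move: (x - z) => w w0; set r := enorm w.
have r0 : 0 < r by rewrite lt_neqAle eq_sym enorm_eq0 w0 enorm_ge0.
rewrite -sqr_enorm -/r.
have G0 : 0 < 2 * G1 (r ^+ 2) by rewrite !mulr_gt0// exprn_gt0// exprn_gt0.
rewrite enormZ gtr0_norm// -/r scalerA.
have -> : (2 * G1 (r ^+ 2) * r)^-1 * (2 * G1 (r ^+ 2)) = r^-1.
  by rewrite invfM mulrAC mulVf ?mul1r// gt_eqF.
rewrite mxtraceD mxtraceZ mxtrace_trmul mxtrace_scalar -sqr_enorm -/r.
rewrite [(_ *: _)^T]linearZ/= mulmxDr mulmxDl mul_mx_scalar -!scalemxAr -!scalemxAl.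
rewrite mulmxA -mulmxA [w *m w^T]mx11_scalar mulmx_trE -sqr_enorm -/r.
rewrite mul_scalar_mx !mxE !eqxx !mulr1n.
have r2 : (r ^+ 2) ^+ k.+1 * r = r ^+ (2 * k + 3).
  by rewrite -exprM -exprSr; congr (_ ^+ _); lia.
have r3 : (r ^+ 2) ^+ k.+1 = r ^+ (2 * k + 2).
  by rewrite -exprM; congr (_ ^+ _); lia.
have -> : 2 * G1 (r ^+ 2) * r = 2 * k.+2%:R * r ^+ (2 * k + 3).
  by rewrite /G1 -r2; ring.
have -> : 2 * k%:R + 3 = (2 * k + 3)%:R :> R by rewrite natrD natrM.
have -> : 2 * k%:R + 2 = (2 * k + 2)%:R :> R by rewrite natrD natrM.
rewrite powRD ?(gt_eqF r0) ?implybT// powRrM !powR_mulrn ?(ltW r0)//.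
rewrite powRM ?exprn_ge0 ?(ltW r0)//.
rewrite -r3 /G1 /G2 -[X in X + _ + _]mulr_natr.
have G2r : (r ^+ 2) ^+ k * r ^+ 2 = (r ^+ 2) ^+ k.+1 by rewrite [RHS]exprSr.
set x2 := (r ^+ 2) ^+ k.+1 in G2r *; set x0 := (r ^+ 2) ^+ k in G2r *.
rewrite -G2r; field; rewrite gt_eqF//.
Qed.

End PowerTest.

End LocallyConstant.

(** * Positive constants are not subsolutions, and a growth exponent above one forces constancy *)

Section Rigidity.
Context {R : realType} {n : nat}.
Implicit Types (x y z : 'rV[R]_n) (u : 'rV[R]_n -> R).

Lemma powR_small_near (s c eta : R) z : 0 < s -> 0 < eta ->
  \forall x \near z, c * enorm (x - z) `^ s <= eta.
Proof.
move=> s0 eta0; have d0 : 0 < (eta / (`|c| + 1)) `^ s^-1.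
  by rewrite powR_gt0// divr_gt0// ltr_wpDl.
have cE : enorm (x - z) @[x --> z] --> (0 : R).
  by rewrite -(enorm0 (n := n)) -(subrr z); exact: enorm_continuous.
near=> x.
have xd : enorm (x - z) <= (eta / (`|c| + 1)) `^ s^-1.
  by apply: ltW; near: x; exact: cvgr_lt cE _ d0.
have := ge0_ler_powR (ltW s0) _ _ xd.
rewrite !nnegrE enorm_ge0 powR_ge0 -powRrM mulVf ?gt_eqF// powRr1; last first.
  by rewrite divr_ge0 ?addr_ge0// ltW.
move=> /(_ isT isT) /(ler_wpM2l (normr_ge0 c)) h.
apply: le_trans (ler_wpM2r (powR_ge0 _ _) (ler_norm c)) _.
apply: le_trans h _; rewrite mulrCA ger_pMr// ler_pdivrMr ?ltr_wpDl//; lra.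
Unshelve. all: by end_near. Qed.

Lemma lambda_max0 : (0 < n)%N -> lambda_max (0 : 'M[R]_n) = 0.
Proof. by move=> n0; rewrite /lambda_max eigenvalue0_set// sup1. Qed.

Lemma lambda_min0 : (0 < n)%N -> lambda_min (0 : 'M[R]_n) = 0.
Proof. by move=> n0; rewrite /lambda_min eigenvalue0_set// inf1. Qed.

(** A [power_test] touches the constant from above at [z]. Its operator is 0 at [z] if [gamma >= 0]
    and tends to 0 there if [gamma < 0], whereas the right-hand side is positive. *)
Lemma subsolution_not_locally_cst (p gamma m : R) (a u : 'rV[R]_n -> R) Omega z :
  (0 < n)%N -> 1 < p -> -1 < gamma ->
  visc_subsolution p gamma (absorption a m) Omega u ->
  Omega z -> 0 < a z -> 0 < u z ->
  ~ \forall x \near z, u x = u z.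
Proof.
move=> n0 p1 g1 hu Oz az uz ucst.
have f0 : 0 < absorption a m z (u z).
  by rewrite /absorption max_l ?(ltW uz)// mulr_gt0// powR_gt0.
(* With [k * (1 + gamma) > 1], the exponent in [pLaplace_op_power_test], which is
   [(2 * k + 3) * (1 + gamma) - 1], is positive even for [gamma] close to -1. *)
pose k := Num.bound (1 + gamma)^-1; pose phi := power_test (u z) k z.
have phiz : phi z = u z.
  by rewrite /phi /power_test /plane_radial subrr !dot0l expr0n addr0 addr0.
have ta : touches_from_above phi u z.
  split=> //; rewrite phiz subrr; apply: filterS ucst => x ->.
  rewrite /phi /power_test /plane_radial subr_le0 addr0 lerDl exprn_ge0//.
  exact: dot_ge0.
have c2 : class_C2 Omega phi by exact: class_C2_power_test.
move: hu; rewrite /visc_subsolution; case: ifPn => [_ hu|].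
  have g0 : grad phi z = 0 by rewrite grad_power_test subrr scaler0.
  have h0 : hessian phi z = 0.
    rewrite hessian_power_test subrr mulmx0 scaler0 addr0 dot0l expr0n/=.
    by rewrite !mulr0 raddf0.
  have [_ /(_ g0)] := hu _ _ c2 Oz ta.
  rewrite /laplacian h0 mxtrace0 phiz lambda_max0// lambda_min0// mulr0 addr0.
  by case=> h1 h2; move: f0; rewrite ltNge; case: (leP 2 p) => [/h1|/h2] ->.
rewrite -ltNge => gneg hu.
have gradn0 x : Omega x -> x <> z -> grad phi x != 0.
  move=> _ /eqP xz; rewrite grad_power_test scaler_eq0 negb_or subr_eq0 xz andbT.
  do 2!(apply: mulf_neq0; first by rewrite pnatr_eq0).
  by rewrite expf_neq0// dot_eq0 subr_eq0.
have := hu _ _ c2 Oz ta gradn0; rewrite phiz; apply/negP; rewrite -ltNge.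
set f := absorption a m z (u z) in f0 *.
apply: (@lt_le_trans _ _ (- (f / 2))%:E); first by rewrite lte_fin; lra.
apply: lim_neg_op_values_ge.
have s0 : 0 < (2 * k%:R + 3) * gamma + (2 * k%:R + 2).
  have g0 : 0 < 1 + gamma by lra.
  have : (1 + gamma)^-1 < k%:R by apply: archi_boundP; rewrite invr_ge0 ltW.
  rewrite -[_^-1]mul1r ltr_pdivrMr//; lra.
have f20 : 0 < f / 2 by lra.
apply: filterS (powR_small_near _ _ _ z s0 f20) => x opx /eqP xz.
by rewrite pLaplace_op_power_test//; exact: opx.
Qed.

(* Halving the step improves the constant by the factor [2 `^ (1 - beta) < 1]. *)
Lemma holder_gt1_le u (C beta d : R) z : 1 < beta -> 0 <= C ->
  (forall x y, eball z d x -> eball z d y ->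
     u x <= u y + C * enorm (x - y) `^ beta) ->
  forall x y, eball z d x -> eball z d y -> u x <= u y.
Proof.
move=> beta1 C0 hol; pose th : R := 2 * 2^-1 `^ beta.
have th0 : 0 < th by rewrite mulr_gt0// powR_gt0 invr_gt0.
have th1 : th < 1.
  suff : 2^-1 `^ beta < 2^-1 :> R by rewrite /th; lra.
  rewrite -(@mulr_powRB1 _ 2^-1 beta) ?invr_ge0//; last by lra.
  have p1 : 1 `^ (beta - 1) = 1 :> R by rewrite powR1.
  rewrite gtr_pMr ?invr_gt0// -[ltRHS]p1.
  by rewrite gt0_ltr_powR ?nnegrE ?subr_gt0 ?invr_ge0// invf_lt1// ltr1n.
have mid x y : eball z d x -> eball z d y -> eball z d (2^-1 *: (x + y)).
  rewrite /eball/= => xd yd.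
  have -> : 2^-1 *: (x + y) - z = 2^-1 *: ((x - z) + (y - z)).
    by apply/rowP => i; rewrite !mxE; field.
  rewrite enormZ ger0_norm ?invr_ge0//.
  have := ler_enormD (x - z) (y - z); lra.
(* Pass from [x] to [y] through the midpoint, which stays in the ball by convexity; the two
   half-steps together cost the factor [th]. *)
have iter k x y : eball z d x -> eball z d y ->
    u x <= u y + C * th ^+ k * enorm (x - y) `^ beta.
  elim: k x y => [|k IH] x y xd yd; first by rewrite expr0 mulr1; exact: hol.
  have md := mid _ _ xd yd; set w := 2^-1 *: _ in md.
  have half v v' : v - w = 2^-1 *: v' -> enorm (v - w) `^ beta = 2^-1 `^ beta * enorm v' `^ beta.
    by move=> ->; rewrite enormZ ger0_norm ?invr_ge0// powRM ?invr_ge0// enorm_ge0.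
  have h1 := IH _ _ xd md; have h2 := IH _ _ md yd.
  rewrite (half x (x - y)) in h1; last first.
    by apply/rowP => i; rewrite /w !mxE; field.
  rewrite -enormN opprB (half y (y - x)) in h2; last first.
    by apply/rowP => i; rewrite /w !mxE; field.
  rewrite -(enormN (y - x)) opprB in h2.
  apply: le_trans h1 _; rewrite -lerBrDr; apply: le_trans h2 _.
  by rewrite le_eqVlt exprS /th; apply/orP; left; apply/eqP; ring.
move=> x y xd yd; rewrite leNgt; apply/negP => yx.
have cth : `|th| < 1 by rewrite gtr0_norm.
have cv : C * enorm (x - y) `^ beta * th ^+ k @[k --> \oo] --> (0 : R).
  rewrite -[X in _ --> X](mulr0 (C * enorm (x - y) `^ beta)).
  by apply: cvgM; [exact: cvg_cst|exact: cvg_expr].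
have : 0 < u x - u y by rewrite subr_gt0.
move=> /(cvgr_lt _ cv) [k _ /(_ k (leqnn k))]; have := iter k _ _ xd yd; rewrite mulrAC/=; lra.
Qed.

End Rigidity.

(** * Nondegeneracy *)

Section Nondegeneracy.
Context {R : realType} {n : nat}.
Implicit Types (x y z : 'rV[R]_n) (u : 'rV[R]_n -> R).

(** [C_ND] is the coefficient for which the barrier solves the equation with [a] replaced by
    [lambda0]. Since [gamma + 1 - m > 0], any smaller positive coefficient meets the strict
    condition of [subsolution_no_touching]. *)
Lemma C_ND_spec (gamma m p lambda0 : R) :
  let beta := beta_exp gamma m in
  let D := n%:R - 1 + (p - 1) * (beta - 1) in
  (0 < n)%N -> 1 < p -> 0 <= m -> m < gamma + 1 -> 0 < lambda0 ->
  0 < C_ND gamma n m p lambda0 /\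
  C_ND gamma n m p lambda0 `^ (gamma + 1 - m) * (beta `^ (gamma + 1) * D) = lambda0.
Proof.
move=> beta D n0 p1 m0 mg l0.
have beta1 : 1 < beta by exact: beta_exp_gt1.
have D0 : 0 < D.
  by rewrite /D ltr_wpDl ?subr_ge0 ?ler1n// mulr_gt0 ?subr_gt0.
have b0 : 0 < beta by apply: lt_trans beta1.
have lD : 0 < lambda0 / D by rewrite divr_gt0.
have g0 : gamma + 1 - m != 0 by lra.
rewrite /C_ND -/beta -/D div1r; split; first by rewrite mulr_gt0 ?invr_gt0 ?powR_gt0.
rewrite -powRN [(_ `^ _ * _) `^ _]powRM ?powR_ge0// -!powRrM div1r mulVf// powRr1 ?(ltW lD)//.
rewrite mulNr divfK// powRN; field; rewrite !gt_eqF// powR_gt0//.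
Qed.

Lemma closed_eball_compact z (r : R) : compact [set x | enorm (x - z) <= r].
Proof.
apply: bounded_closed_compact.
  exists (r + `|z|); split; first exact: num_real.
  move=> M rM x /= xr; apply: ltW; apply: le_lt_trans rM.
  rewrite -[x](subrK z); apply: le_trans (ler_normD _ _) _.
  by rewrite lerD2r (le_trans (normr_le_enorm _)).
rewrite (_ : [set x | _] = (fun x => enorm (x - z)) @^-1` [set s | s <= r])//.
apply: preimage_closed; last exact: closed_le.
by move=> x _; exact: enorm_continuous.
Qed.

Lemma enorm_powR_continuous z (beta : R) : 1 < beta ->
  continuous (fun x => enorm (x - z) `^ beta).
Proof.
move=> beta1 x; have [->|xz] := eqVneq x z; last first.
  apply: (@continuous_powR _ _ (fun x => enorm (x - z))).
    exact: enorm_continuous.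
  by rewrite lt_neqAle eq_sym enorm_eq0 subr_eq0 xz enorm_ge0.
have b0 : 0 < beta by lra.
rewrite /continuous_at subrr enorm0 powR0 ?gt_eqF//.
have FF := @nbhs_filter _ z; apply/cvgr0Pnorm_le => e e0.
apply: filterS (powR_small_near _ 1 _ z b0 e0) => w.
by rewrite mul1r ger0_norm ?powR_ge0.
Qed.

Lemma closure_eball_sub y (r : R) : closure (eball y r) `<=` [set x | enorm (x - y) <= r].
Proof.
move=> x /= clx; rewrite leNgt; apply/negP => rx.
have [w [/= wr]] := clx _ (cvgr_gt _ (@enorm_continuous _ _ y x) _ rx).
by move=> /(lt_trans wr); rewrite ltxx.
Qed.

(** The claim says that [g] is maximal at the centre. A maximum exists by compactness and is at
    least [g z = u z > 0], while [g < 0] on the sphere; an interior maximum other than [z] is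
    excluded by [subsolution_no_touching]. *)
Lemma subsolution_max_at_center (p gamma m lambda0 C r : R)
    (a u : 'rV[R]_n -> R) Omega z :
  let beta := beta_exp gamma m in
  (0 < n)%N -> 1 < p -> 0 <= m -> m < gamma + 1 -> 0 < C -> 0 < r ->
  C `^ (gamma + 1 - m) * (beta `^ (gamma + 1) *
    (n%:R - 1 + (p - 1) * (beta - 1))) < lambda0 ->
  visc_subsolution p gamma (absorption a m) Omega u ->
  [set x | enorm (x - z) <= r] `<=` Omega ->
  {in Omega, continuous u} -> (forall x, Omega x -> lambda0 <= a x) ->
  0 < u z -> (forall x, enorm (x - z) = r -> u x < C * r `^ beta) ->
  forall x, enorm (x - z) <= r -> u x <= u z + C * enorm (x - z) `^ beta.
Proof.
move=> beta n0 p1 m0 mg C0 r0 Clam hu sub cu la uz ur.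
have beta1 : 1 < beta by exact: beta_exp_gt1.
have beta0 : beta != 0 by apply: lt0r_neq0; exact: lt_trans beta1.
pose g x := u x - C * enorm (x - z) `^ beta.
have Kz : [set x | enorm (x - z) <= r] z by rewrite /= subrr enorm0 ltW.
have [|c] := @EVT_max_rV _ _ g _ (ex_intro _ z Kz) (closed_eball_compact z r).
  apply: continuous_in_subspaceT => x; rewrite inE => /sub Ox.
  have ceb := enorm_powR_continuous z _ beta1 x.
  have cC : {for x, continuous (fun _ : 'rV[R]_n => C)} by exact: cst_continuous.
  have cux : {for x, continuous u} by apply: cu; rewrite inE.
  exact: (continuousB cux (continuousM cC ceb)).
rewrite inE/= => cr cmax.
have gz : g z = u z by rewrite /g subrr enorm0 powR0// mulr0 subr0.
have [cz|cz] := eqVneq c z.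
  by move=> x xr; have := cmax _ (mem_set xr); rewrite cz gz /g lerBlDr.
exfalso.
have gc : u z <= g c by rewrite -gz; exact: cmax (mem_set Kz).
have cr' : enorm (c - z) < r.
  rewrite lt_neqAle cr andbT; apply/eqP => crE.
  by have := ur c crE; rewrite /g crE in gc; lra.
apply: (@subsolution_no_touching _ _ p gamma m lambda0 C a u Omega z c) => //.
- exact: sub.
- by apply: la; exact: sub.
(* Positivity of the maximum is what makes the barrier at most [u] at [c]. *)
- by rewrite /g in gc; lra.
- have : \forall x \near c, enorm (x - z) < r.
    exact: cvgr_lt (@enorm_continuous _ _ z c) _ cr'.
  by apply: filterS => x /ltW xr; exact: cmax (mem_set xr).
Qed.

End Nondegeneracy.

Theorem theorem1p4 (R : realType) (n : nat) (p gamma m lambda0 : R)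
    (a u : 'rV[R]_n -> R) (y : 'rV[R]_n)
    (hn : (0 < n)%N) (hp : 1 < p) (hgamma : -1 < gamma)
    (hm0 : 0 <= m) (hm : m < gamma + 1)
    (ha_pos : forall x, eball 0 1 x -> 0 < a x)
    (ha_cont : {in eball 0 1, continuous a})
    (hlambda0 : 0 < lambda0)
    (ha_inf : lambda0 <= inf [set a x | x in eball 0 1])
    (hu_cont : {in eball 0 1, continuous u})
    (hu_ge0 : forall x, eball 0 1 x -> 0 <= u x)
    (hu_bnd : [bounded u x | x in eball 0 1])
    (hu_sol : visc_solution p gamma (absorption a m) (eball 0 1) u)
    (hy : (closure [set x | eball 0 1 x /\ 0 < u x] `&` eball 0 (1 / 2)) y) :
  0 < C_ND gamma n m p lambda0 /\
  forall r : R, 0 < r -> r < 1 / 2 ->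
    sup [set u x | x in closure (eball y r)]
      >= C_ND gamma n m p lambda0 * r `^ beta_exp gamma m.
Proof.
have [C0 CE] := @C_ND_spec R n gamma m p lambda0 hn hp hm0 hm hlambda0.
split=> // r r0 r1; rewrite leNgt; apply/negP.
set M := sup _; set C := C_ND _ _ _ _ _ in C0 CE *; set beta := beta_exp gamma m in CE *.
move=> MC.
have beta1 : 1 < beta by exact: beta_exp_gt1.
have [hu _] := hu_sol; have [hy1 hy2] := hy.
have inB1 x : enorm (x - y) <= r -> eball 0 1 x.
  move=> xr; rewrite /eball/= in hy2 *; have := ler_enormD (x - y) (y - 0).
  by rewrite addrA subrK; lra.
have uM x : enorm (x - y) < r -> u x <= M.
  move=> xr; apply: ub_le_sup; last by exists x => //; exact: subset_closure.
  have [N [_ hN]] := hu_bnd; exists (N + 1) => _ [w /closure_eball_sub/inB1 w1 <-].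
  by apply: le_trans (ler_norm _) _; apply: hN => //; rewrite ltrDl.
have la x : eball 0 1 x -> lambda0 <= a x.
  move=> x1; apply: le_trans ha_inf _; apply: inf_lbound; last by exists x.
  by exists 0 => _ [w w1 <-]; apply: ltW; exact: ha_pos.
(* A single [s < 1] shrinks both the coefficient and the radius: at [s = 1] the inequality is the
   assumption [MC], and by continuity it persists for [s] slightly below 1. *)
have [s s0 [s1 Ms]] : exists2 s, 0 < s & s < 1 /\ M < C * s * (r * s) `^ beta.
  have : \forall s \near (1 : R), M < C * r `^ beta * s `^ (beta + 1).
    have c1 : {for (1 : R), continuous (fun s : R => C * r `^ beta * s `^ (beta + 1))}.
      apply: (@continuousM R R (fun=> _) (fun s => s `^ (beta + 1))).
        exact: cst_continuous.
      exact: powR_continuous_at.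
    by apply: (cvgr_gt _ c1); rewrite powR1 mulr1.
  move=> /nbhs_ballP[d /= d0 dP].
  (* The bound [d / 2] keeps [s] in the neighbourhood of 1, the bound [1 / 2] keeps it positive. *)
  pose s := 1 - Num.min (d / 2) (1 / 2).
  have [s0 s1] : 0 < s /\ s < 1.
    rewrite /s subr_gt0 gtrBl gt_min lt_min; split; last by apply/andP; lra.
    by apply/orP; right; lra.
  exists s => //; split=> //.
  have /dP : `|1 - s| < d.
    rewrite /s opprB addrC subrK ger0_norm ?le_min; last by apply/andP; split; lra.
    by rewrite gt_min; apply/orP; left; lra.
  rewrite powRM ?(ltW r0) ?(ltW s0)// powRD ?(gt_eqF s0) ?implybT// powRr1 ?ltW//.
  by congr (_ < _); ring.
have rs : r * s < r by rewrite gtr_pMr.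
(* Since [y] is in the closure of the positivity set, [z0] can be taken so close that the closed
   ball of radius [r * s] around it lies in the open ball of radius [r] around [y]. *)
have [z0 [[z01 uz0]]] : [set x | eball 0 1 x /\ 0 < u x] `&` eball y (r - r * s) !=set0.
  apply: hy1; apply: (cvgr_lt _ (@enorm_continuous _ _ y y)).
  by rewrite subrr enorm0 subr_gt0.
rewrite /eball/= => z0y.
(* Both conditions on [z0] are open, so the barrier may be centred at every point of a small
   ball. *)
have : \forall z \near z0, 0 < u z /\ enorm (z - y) < r - r * s.
  near=> z; split; near: z.
    by apply: (cvgr_gt _ (hu_cont z0 (mem_set z01))).
  exact: cvgr_lt (@enorm_continuous _ _ y z0) _ z0y.
move=> /nbhs_eball[d d0 dP].
have rs0 : 0 < r * s by rewrite mulr_gt0.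
have Cs0 : 0 < C * s by rewrite mulr_gt0.
have center z : eball z0 d z -> forall x, enorm (x - z) <= r * s ->
    u x <= u z + C * s * enorm (x - z) `^ beta.
  move=> /dP[uz zy].
  have xy x : enorm (x - z) <= r * s -> enorm (x - y) < r.
    by move=> xz; have := ler_enormD (x - z) (z - y); rewrite addrA subrK; lra.
  apply: (@subsolution_max_at_center _ _ p gamma m lambda0 (C * s) (r * s) a u
    (eball 0 1)) => //.
  - rewrite -[ltRHS]CE ltr_pM2r; last first.
      rewrite mulr_gt0 ?powR_gt0//; first exact: lt_trans beta1.
      by rewrite ltr_wpDl ?subr_ge0 ?ler1n// mulr_gt0 ?subr_gt0.
    rewrite gt0_ltr_powR ?nnegrE ?(ltW C0) ?(ltW Cs0)//; first by lra.
    by rewrite gtr_pMr.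
  - by move=> x /xy/ltW/inB1.
  - by move=> x xz; apply: le_lt_trans Ms; apply: uM; apply: xy; rewrite xz.
(* Two points within [r * s / 2] of [z0] are within [r * s] of each other, so either may serve as
   centre for the other and [holder_gt1_le] applies. *)
pose d' := Num.min d (r * s / 2).
have d'0 : 0 < d' by rewrite lt_min d0 divr_gt0.
have d'd x : eball z0 d' x -> eball z0 d x.
  by rewrite /eball/= => /lt_le_trans; apply; rewrite ge_min lexx.
have ucst := @holder_gt1_le _ _ u (C * s) beta d' z0 beta1 (ltW Cs0).
have {}ucst x w : eball z0 d' x -> eball z0 d' w -> u x <= u w.
  apply: ucst => {}x {}w xd wd; apply: center; first exact: d'd.
  move: xd wd; rewrite /eball/= /d' !lt_min => /andP[_ xd] /andP[_ wd].
  have := ler_enormD (x - z0) (z0 - w).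
  by rewrite addrA subrK -[enorm (z0 - w)]enormN opprB; lra.
(* Exchanging the two points in [ucst] makes [u] constant near [z0], where it is positive. *)
apply: (@subsolution_not_locally_cst _ _ p gamma m a u (eball 0 1) z0) => //.
  exact: ha_pos.
have : \forall x \near z0, enorm (x - z0) < d'.
  by apply: (cvgr_lt _ (@enorm_continuous _ _ z0 z0)); rewrite subrr enorm0.
have z0d : eball z0 d' z0 by rewrite /eball/= subrr enorm0.
by apply: filterS => x xd; apply/eqP; rewrite eq_le !ucst.
Unshelve. all: by end_near. Qed.
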